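(* Let $Q$ be a quadratical quasigroup, let $a,b\in Q$ with $a\neq b$, and let $n\ge 2$. If there exists an $n$-cycle in $Q$ based on $aba$, then $n=4$.
   Context: A groupoid is a nonempty set with a binary operation, written as juxtaposition. A groupoid $G$ is right solvable if for all $a,b\in G$ there is a unique $x\in G$ with $ax=b$. It has property A if $(xy)x=(zx)(yz)$ for all $x,y,z\in G$. A quadratical quasigroup is a right solvable groupoid with property A (such a groupoid is known to be a quasigroup). In a quadratical quasigroup $x(yx)=(xy)x$ for all $x,y$, and this element is written $xyx$. For $a\neq b$ in $Q$, an $n$-cycle based on $aba$ is an ordered list $x_1,x_2,\dots,x_n$ of $n$ distinct elements of $Q$ such that $aba=x_1x_2=x_2x_3=\cdots=x_{n-1}x_n=x_nx_1$. *)

(* Defs.v *)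
From mathcomp Require Import all_boot.

Set Implicit Arguments.
Unset Strict Implicit.
Unset Printing Implicit Defensive.

Local Open Scope group_scope.

(* A magmaType is an arbitrary type with a binary operation, so the
   nonemptiness of a groupoid is imposed in quadratical_quasigroup. *)

Definition right_solvable (Q : magmaType) : Prop :=
  forall a b : Q, exists! x : Q, a * x = b.

Definition property_A (Q : magmaType) : Prop :=
  forall x y z : Q, (x * y) * x = (z * x) * (y * z).

Definition quadratical_quasigroup (Q : magmaType) : Prop :=
  [/\ inhabited Q, right_solvable Q & property_A Q].

(* The element written xyx; the bracketing is immaterial in a quadratical
   quasigroup, by sandwichE. *)
Definition sandwich (Q : magmaType) (x y : Q) : Q := (x * y) * x.

Lemma sandwichE (Q : magmaType) (hQ : quadratical_quasigroup Q) (x y : Q) :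
  x * (y * x) = sandwich x y.
Proof.
case: hQ => _ solvQ AQ.
have mulxx : x * x = x.
  have [u [_ uniq_u]] := solvQ (x * x) ((x * x) * x).
  by rewrite -(uniq_u _ (esym (AQ x x x))) (uniq_u x).
by rewrite /sandwich (AQ x y x) mulxx.
Qed.

(* An ordered list of n distinct elements is an injective family indexed by
   'I_n (indices shifted to 0, ..., n - 1); ordS is the cyclic successor, so
   i = n - 1 gives the closing equation x_n x_1 = aba. *)
Definition cycle_based_on (Q : magmaType) (a b : Q) (n : nat) (x : 'I_n -> Q)
  : Prop :=
  injective x /\ forall i : 'I_n, x i * x (ordS i) = sandwich a b.

(* Main.v *)
Require Import Defs.
From mathcomp Require Import all_boot.

(** In a quadratical quasigroup, fix [c] and let each [u] be followed by the
    unique solution [s u] of [u * s u = c].  In the affine model, where [c] is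
    the origin and [u * v = (1 - t) u + t v] with [2 t ^ 2 - 2 t + 1 = 0], the
    map [s] is multiplication by [(t - 1) / t], whose square is [-1]: a quarter
    turn about [c].  So every [s]-orbit closes after four steps, and it cannot
    close after two unless it is a single point.

    Without coordinates, property A and left cancellation give the same turn.
    For three consecutive points [x], [y], [z] of an orbit, [consecutive_prod]
    gives [z * x = y]; with [z = x] it says [x * x = y], which by idempotence
    rules out 2-cycles.
    With a fourth point [w], it yields [(w * x) * c = c], whence [w * x = c]
    ([fourth_step]): the successor of [w] is [x].  In a cycle of [n] distinct
    points, the fourth successor of the first point is thus that point itself,
    so [n] divides 4, and [n] is neither 1 nor 2. *)

Local Open Scope group_scope.

Lemma right_solvable_inj {Q : magmaType} (a : Q) :
  right_solvable Q -> injective (fun x : Q => a * x).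
Proof.
move=> solvQ x y eq_axy; have [u [_ uniq_u]] := solvQ a (a * y).
by rewrite -(uniq_u x eq_axy) (uniq_u y).
Qed.

Lemma quadratical_idem (Q : magmaType) (x : Q) :
  quadratical_quasigroup Q -> x * x = x.
Proof.
case=> _ solvQ AQ; apply: (right_solvable_inj (x * x) solvQ).
by rewrite -AQ.
Qed.

(** The absorption [p * c = c] turns each of the equal products [c * (p * c)]
    and [(c * p) * c = (p * c) * p] into [c] and [c * p] respectively; so
    cancellation of a right factor, which is not an axiom, follows in the
    idempotent case from cancellation on the left. *)
Lemma mul_eq_right (Q : magmaType) (p c : Q) :
  quadratical_quasigroup Q -> p * c = c -> p = c.
Proof.
move=> hQ pc; have [_ solvQ AQ] := hQ.
have cpc : c * p = c.
  have swapE : (p * c) * p = (c * p) * c by rewrite (AQ p c c) quadratical_idem.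
  by rewrite -{1}pc swapE -/(sandwich c p) -sandwichE // pc quadratical_idem.
by apply: (right_solvable_inj c solvQ); rewrite cpc quadratical_idem.
Qed.

(** Property A rewrites [c * y = (y * z) * y] as [(x * y) * (z * x)], that is
    [c * (z * x)], and [c] cancels. *)
Lemma consecutive_prod {Q : magmaType} {c x y z : Q} :
  quadratical_quasigroup Q -> x * y = c -> y * z = c -> z * x = y.
Proof.
case=> _ solvQ AQ xy yz; apply: (right_solvable_inj c solvQ).
by rewrite -{1}xy -AQ yz.
Qed.

(** By property A, [(w * x) * (z * w) = (x * z) * x], and the right-hand side
    is [x * (z * x) = x * y = c]. *)
Lemma fourth_step {Q : magmaType} {c x y z w : Q} :
  quadratical_quasigroup Q ->
  x * y = c -> y * z = c -> z * w = c -> w * x = c.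
Proof.
move=> hQ xy yz zw; have [_ _ AQ] := hQ; apply: mul_eq_right => //.
rewrite -{1}zw -AQ -/(sandwich x z) -sandwichE //.
by rewrite (consecutive_prod hQ xy yz).
Qed.

Local Close Scope group_scope.

Lemma val_iter_ordS (n k : nat) (i : 'I_n) :
  iter k (@ordS n) i = (i + k) %% n :> nat.
Proof.
elim: k => [|k IHk] /=; first by rewrite addn0 modn_small.
by rewrite IHk -addn1 modnDml addn1 addnS.
Qed.

Theorem proposition3p1 (Q : magmaType) (hQ : quadratical_quasigroup Q)
  (a b : Q) (hab : a <> b) (n : nat) (hn : 2 <= n)
  (hcycle : exists x : 'I_n -> Q, cycle_based_on a b x) :
  n = 4.
Proof.
have [_ solvQ _] := hQ; case: hcycle => x [inj_x step].
pose i0 : 'I_n := Ordinal (ltnW hn); pose p k := iter k (@ordS n) i0.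
have stepp k : (x (p k) * x (p k.+1))%g = sandwich a b by apply: step.
have val_p k : p k = k %% n :> nat by exact: val_iter_ordS.
have p4 : p 4 = p 0.
  apply/inj_x/(right_solvable_inj (x (p 3)) solvQ); rewrite stepp.
  by rewrite (fourth_step hQ (stepp 0) (stepp 1) (stepp 2)).
have n_dvd4 : n %| 4.
  by rewrite /dvdn -(val_p 4) p4.
have n_neq2 : n != 2.
  apply/eqP=> n2.
  have p2 : p 2 = p 0 by apply: ord_inj; rewrite !val_p n2.
  have xx := stepp 1; rewrite p2 in xx.
  have p1 : p 0 = p 1.
    apply: inj_x; rewrite -(consecutive_prod hQ (stepp 0) xx).
    by rewrite quadratical_idem.
  by move/(congr1 (@nat_of_ord n)): p1; rewrite !val_p n2.
have n_le4 : n <= 4 by apply: dvdn_leq.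
clear - hn n_dvd4 n_neq2 n_le4.
by case: n hn n_dvd4 n_neq2 n_le4 => [|[|[|[|[|n]]]]].
Qed.
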